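(* $\textsc{Dense-Linear-Ordering}\le_{dt}\textsc{Lossy-Code}$.
   Context: Query model: inputs are accessed by bit queries; $R\le_{dt}S$ means a reduction where the $S$-instance's input bits are computed by decision trees over the $R$-input and $S$-solutions are mapped back to $R$-solutions by decision trees, with log of the $S$-input length plus maximum depth at most $\mathrm{polylog}(N)$. $\textsc{Lossy-Code}$: given $f:[M]\to[2M]$, $g:[2M]\to[M]$, find $x\in[2M]$ with $f(g(x))\neq x$. $\textsc{Dense-Linear-Ordering}$: the input is a relation $\prec$ on $[N]$ such that for all $x\neq y$ exactly one of $x\prec y$, $y\prec x$ holds (given by $\binom N2$ bits), and a symmetric median function $\mathsf{med}:[N]\times[N]\to[N]$ (with $\mathsf{med}(x,y)=\mathsf{med}(y,x)$). A solution is either $x,y,z\in[N]$ with $x\prec y$, $y\prec z$, $z\prec x$; or $x,y\in[N]$ with $x\prec y$ but neither $x\prec\mathsf{med}(x,y)$ nor $\mathsf{med}(x,y)\prec y$.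
   Formalization: A density solution is x≺y where at least one of x≺med(x,y), med(x,y)≺y fails (literally ''neither…nor'' leaves linear orders with no solution, making the claim false); sizes are N≥2 and M≥1, where solutions always exist. *)

(* Defs.v *)
From mathcomp Require Import all_boot.

Set Implicit Arguments.
Unset Strict Implicit.
Unset Printing Implicit Defensive.

Inductive dtree (I A : Type) : Type :=
| Leaf of A
| Query of I & dtree I A & dtree I A.

Fixpoint dt_depth (I A : Type) (t : dtree I A) : nat :=
  match t with
  | Leaf _ => 0
  | Query _ t0 t1 => (maxn (dt_depth t0) (dt_depth t1)).+1
  end.

Fixpoint dt_eval (I A : Type) (t : dtree I A) (w : I -> bool) : A :=
  match t with
  | Leaf a => a
  | Query i t0 t1 => if w i then dt_eval t1 w else dt_eval t0 w
  end.

(* A search problem of one fixed size. The bits of an instance are indexed by  *)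
(* the finite type [qbit], so the input length is #|qbit|. Strings in          *)
(* qbit -> bool outside the range of [qenc] encode no instance and play no     *)
(* role: see [dt_reduction].                                                   *)
Record query_problem := QueryProblem {
  qbit : finType;
  qinst : Type;
  qenc : qinst -> qbit -> bool;
  qsol : finType;
  qvalid : qinst -> qsol -> bool
}.

(* [T] computes the bits of the S-instance and [G] maps the S-solutions back.  *)
(* The string computed by [T] has to encode a genuine S-instance.              *)
Definition dt_reduction (R S : query_problem)
    (T : qbit S -> dtree (qbit R) bool)
    (G : qsol S -> dtree (qbit R) (qsol R)) : Prop :=
  forall x : qinst R, exists y : qinst S,
    (forall b : qbit S, qenc y b = dt_eval (T b) (qenc x)) /\
    (forall o : qsol S, qvalid y o -> qvalid x (dt_eval (G o) (qenc x))).

Definition dt_complexity (R S : query_problem)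
    (T : qbit S -> dtree (qbit R) bool)
    (G : qsol S -> dtree (qbit R) (qsol R)) : nat :=
  up_log 2 #|qbit S|
    + maxn (\max_(b : qbit S) dt_depth (T b)) (\max_(o : qsol S) dt_depth (G o)).

(* Problems are families indexed by their size parameter; polylog is taken in  *)
(* the input length of R, with one constant for the whole family.              *)
Definition dt_reducible (I J : Type)
    (R : I -> query_problem) (S : J -> query_problem) : Prop :=
  exists c : nat, forall i : I, exists j : J,
  exists T : qbit (S j) -> dtree (qbit (R i)) bool,
  exists G : qsol (S j) -> dtree (qbit (R i)) (qsol (R i)),
    dt_reduction T G /\
    dt_complexity T G <= c * up_log 2 #|qbit (R i)| ^ c + c.

Notation "R <=dt S" := (dt_reducible R S) (at level 70, no associativity).

(* Least significant bit first. *)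
Definition nat_bit (m k : nat) : bool := odd (m %/ 2 ^ k).

Lemma nat_bit_inj (k m n : nat) : m < 2 ^ k -> n < 2 ^ k ->
  (forall i : 'I_k, nat_bit m i = nat_bit n i) -> m = n.
Proof.
elim: k m n => [|k IHk] m n; first by rewrite expn0 !ltnS !leqn0 => /eqP-> /eqP->.
move=> ltm ltn eqb.
have eq0 : odd m = odd n by have := eqb ord0; rewrite /nat_bit expn0 !divn1.
have half_lt p : p < 2 ^ k.+1 -> p./2 < 2 ^ k.
  by rewrite expnSr -divn2 ltn_divLR.
rewrite -(odd_double_half m) -(odd_double_half n) eq0; congr (_ + _.*2).
apply: IHk; [exact: half_lt | exact: half_lt | move=> i].
have := eqb (lift ord0 i).
by rewrite /nat_bit lift0 expnS !divnMA !divn2.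
Qed.

Lemma ord_bit_inj (n : nat) (x y : 'I_n) :
  (forall i : 'I_(up_log 2 n), nat_bit x i = nat_bit y i) -> x = y.
Proof.
have lt_n (z : 'I_n) : z < 2 ^ up_log 2 n.
  by apply: leq_trans (ltn_ord z) _; apply: up_logP.
by move=> eqb; apply: val_inj; apply: nat_bit_inj eqb.
Qed.

Record lossy_input (M : nat) := LossyInput {
  lc_f : {ffun 'I_M -> 'I_(2 * M)};
  lc_g : {ffun 'I_(2 * M) -> 'I_M}
}.

Definition lossy_bit (M : nat) : Type :=
  ('I_M * 'I_(up_log 2 (2 * M)) + 'I_(2 * M) * 'I_(up_log 2 M))%type.

Definition lossy_enc (M : nat) (w : lossy_input M) (b : lossy_bit M) : bool :=
  match b with
  | inl (x, k) => nat_bit (lc_f w x) k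
  | inr (x, k) => nat_bit (lc_g w x) k
  end.

Lemma lossy_enc_inj (M : nat) (v w : lossy_input M) :
  lossy_enc v =1 lossy_enc w -> v = w.
Proof.
case: v w => [f g] [f' g'] eqe; congr LossyInput; apply/ffunP => x.
  by apply: ord_bit_inj => k; apply: (eqe (inl (x, k))).
by apply: ord_bit_inj => k; apply: (eqe (inr (x, k))).
Qed.

Definition lossy_valid (M : nat) (w : lossy_input M) (x : 'I_(2 * M)) : bool :=
  lc_f w (lc_g w x) != x.

(* M = 0 is excluded: there [2M] is empty and the search problem is not total. *)
Definition lossy_code (M : {M : nat | 0 < M}) : query_problem :=
  @QueryProblem (lossy_bit (sval M)) (lossy_input (sval M)) (@lossy_enc (sval M))
    'I_(2 * sval M) (@lossy_valid (sval M)).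

Record dlo_input (N : nat) := DloInput {
  dlo_prec : rel 'I_N;
  dlo_prec_irr : forall x, ~~ dlo_prec x x;
  dlo_prec_tot : forall x y, x != y -> dlo_prec x y (+) dlo_prec y x;
  dlo_med : 'I_N -> 'I_N -> 'I_N;
  dlo_medC : forall x y, dlo_med x y = dlo_med y x
}.

(* One bit of the order per pair x < y, and the bits of the median for the     *)
(* pairs x <= y, both comparisons being those of the labels in {0,..,N-1}: the *)
(* rest is determined by irreflexivity, totality and symmetry.                 *)
Definition dlo_bit (N : nat) : Type :=
  ({p : 'I_N * 'I_N | p.1 < p.2}
   + {p : 'I_N * 'I_N | p.1 <= p.2} * 'I_(up_log 2 N))%type.

Definition dlo_enc (N : nat) (w : dlo_input N) (b : dlo_bit N) : bool :=
  match b with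
  | inl p => dlo_prec w (sval p).1 (sval p).2
  | inr (p, k) => nat_bit (dlo_med w (sval p).1 (sval p).2) k
  end.

Lemma dlo_enc_inj (N : nat) (v w : dlo_input N) : dlo_enc v =1 dlo_enc w ->
  dlo_prec v =2 dlo_prec w /\ dlo_med v =2 dlo_med w.
Proof.
move=> eqe.
have eqp (x y : 'I_N) : x < y -> dlo_prec v x y = dlo_prec w x y.
  by move=> ltxy; apply: (eqe (inl (exist _ (x, y) ltxy))).
have eqm (x y : 'I_N) : x <= y -> dlo_med v x y = dlo_med w x y.
  move=> lexy; apply: ord_bit_inj => k.
  exact: (eqe (inr (exist _ (x, y) lexy, k))).
split=> x y; last first.
  have [|/ltnW] := leqP x y; first exact: eqm.
  by move=> leyx; rewrite dlo_medC [RHS]dlo_medC eqm.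
case: (ltngtP x y) => [|ltyx|/val_inj ->]; first exact: eqp.
  have neq : x != y by rewrite -val_eqE gtn_eqF.
  have := dlo_prec_tot v neq; have := dlo_prec_tot w neq.
  by rewrite (eqp _ _ ltyx); do 3!case: dlo_prec.
by rewrite (negbTE (dlo_prec_irr v y)) (negbTE (dlo_prec_irr w y)).
Qed.

Definition dlo_sol (N : nat) : Type := ('I_N * 'I_N * 'I_N + 'I_N * 'I_N)%type.

(* A pair x < y violates density as soon as x < med x y < y fails, that is if  *)
(* at least one of the two inequalities fails. Requiring both to fail would    *)
(* leave linear orders with med = min without any solution.                    *)
Definition dlo_valid (N : nat) (w : dlo_input N) (s : dlo_sol N) : bool :=
  match s with
  | inl (x, y, z) => [&& dlo_prec w x y, dlo_prec w y z & dlo_prec w z x]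
  | inr (x, y) => dlo_prec w x y &&
      ~~ (dlo_prec w x (dlo_med w x y) && dlo_prec w (dlo_med w x y) y)
  end.

(* For N <= 1 there is no pair x < y, hence no solution: the search problem is *)
(* total exactly from N = 2 on.                                                *)
Definition dense_linear_ordering (N : {N : nat | 1 < N}) : query_problem :=
  @QueryProblem (dlo_bit (sval N)) (dlo_input (sval N)) (@dlo_enc (sval N))
    (dlo_sol (sval N)) (@dlo_valid (sval N)).

(* Main.v *)
(** Let M be the least power of two with N <= M. Bisecting an initial interval by
    medians log(2M) times makes every one of 2M bit strings p name an interval;
    g sends p to its left endpoint, and f sends a point z to the string that the
    binary search for z follows. On a dense linear order f (g p) = p. That
    equation only involves the O(log M) endpoints of the intervals met on the way
    to p, so when it fails some pair or triple of these endpoints is a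
    solution; all of them are tested. *)
Require Import Defs.
From mathcomp Require Import all_boot zify.

Set Implicit Arguments.
Unset Strict Implicit.
Unset Printing Implicit Defensive.

(** * Functions computed by decision trees of bounded depth *)

Fixpoint dt_bind (I A B : Type) (t : dtree I A) (k : A -> dtree I B) : dtree I B :=
  match t with
  | Leaf a => k a
  | Query i t0 t1 => Query i (dt_bind t0 k) (dt_bind t1 k)
  end.

Lemma dt_eval_bind (I A B : Type) (t : dtree I A) (k : A -> dtree I B) w :
  dt_eval (dt_bind t k) w = dt_eval (k (dt_eval t w)) w.
Proof. by elim: t => //= i t0 IH0 t1 IH1; case: (w i). Qed.

Lemma dt_depth_bind (I A B : Type) (t : dtree I A) (k : A -> dtree I B) n :
  (forall a, dt_depth (k a) <= n) -> dt_depth (dt_bind t k) <= dt_depth t + n.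
Proof. by move=> kn; elim: t => //= i t0 IH0 t1 IH1; lia. Qed.

(** The tree is kept as data in [Type], so that a family of trees indexed by [a] is already the
    continuation that [dt_bind] takes, without choice. *)
Definition dt_computes (R : query_problem) (A : Type) (n : nat)
    (F : qinst R -> A) : Type :=
  {t : dtree (qbit R) A | dt_depth t <= n & forall x, dt_eval t (qenc x) = F x}.

Section Computes.
Variable R : query_problem.
Implicit Types (A B : Type) (m n : nat).

Lemma dt_computes_leq A m n (F : qinst R -> A) :
  m <= n -> dt_computes m F -> dt_computes n F.
Proof. by move=> lemn [t lt tF]; exists t => //; apply: leq_trans lemn. Qed.

Lemma dt_computes_const A (a : A) : dt_computes 0 (fun _ : qinst R => a).
Proof. by exists (Leaf _ a). Qed.

Lemma dt_computes_bit (b : qbit R) : dt_computes 1 (fun x : qinst R => qenc x b).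
Proof. by exists (Query b (Leaf _ false) (Leaf _ true)) => //= x; case: qenc. Qed.

Lemma dt_computes_bind A B m n (F : qinst R -> A) (G : A -> qinst R -> B) :
  dt_computes m F -> (forall a, dt_computes n (G a)) ->
  dt_computes (m + n) (fun x => G (F x) x).
Proof.
move=> [t tm tF] cG; exists (dt_bind t (fun a => s2val (cG a))).
  apply: leq_trans (leq_add tm (leqnn n)).
  by apply: dt_depth_bind => a; case: (cG a).
by move=> x; rewrite dt_eval_bind tF; case: (cG (F x)).
Qed.

Lemma dt_computes_comp A B n (F : qinst R -> A) (h : A -> B) :
  dt_computes n F -> dt_computes n (fun x => h (F x)).
Proof.
move=> cF; rewrite -[n]addn0.
exact: (dt_computes_bind cF (fun a => dt_computes_const (h a))).
Qed.

Lemma dt_computes_and m n (P Q : qinst R -> bool) :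
  dt_computes m P -> dt_computes n Q -> dt_computes (m + n) (fun x => P x && Q x).
Proof.
move=> cP cQ; apply: (dt_computes_bind (G := fun b x => b && Q x) cP) => b.
exact: dt_computes_comp.
Qed.

Lemma dt_computes_map A B n (F : A -> qinst R -> B) (s : seq A) :
  (forall a, dt_computes n (F a)) ->
  dt_computes (size s * n) (fun x => [seq F a x | a <- s]).
Proof.
move=> cF; elim: s => [|a s IHs] /=; first exact: dt_computes_const.
rewrite mulSn.
apply: (dt_computes_bind (G := fun b x => b :: [seq F a x | a <- s]) (cF a)) => b.
exact: dt_computes_comp.
Qed.

Lemma dt_computes_find A n (P : A -> qinst R -> bool) (s : seq A) :
  (forall a, dt_computes n (P a)) ->
  dt_computes (size s * n) (fun x => find (P^~ x) s).
Proof.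
move=> cP; have := dt_computes_comp (find id) (dt_computes_map s cP).
case=> t tn tP; exists t => // x; rewrite tP.
by elim: s {t tn tP} => //= a s ->.
Qed.

End Computes.

(** Separates correctness from query cost: since [Y] produces genuine S-instances, the computed
    string is an encoding by construction. *)
Lemma dt_reduction_of_computes (R S : query_problem) (Y : qinst R -> qinst S)
    (B : qsol S -> qinst R -> qsol R) n :
  (forall b, dt_computes n (fun x => qenc (Y x) b)) ->
  (forall o, dt_computes n (B o)) ->
  (forall x o, qvalid (Y x) o -> qvalid x (B o x)) ->
  exists T G, @dt_reduction R S T G /\
    dt_complexity T G <= up_log 2 #|qbit S| + n.
Proof.
move=> cT cG valB; exists (fun b => s2val (cT b)), (fun o => s2val (cG o)); split.
  move=> x; exists (Y x); split=> [b|o vo]; first by case: (cT b).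
  by case: (cG o) => /= t _ ->; apply: valB.
rewrite leq_add2l geq_max; apply/andP; split.
  by apply/bigmax_leqP => b _; case: (cT b).
by apply/bigmax_leqP => o _; case: (cG o).
Qed.

(** * Cost of reading the order, the median and the validity of a candidate *)

Section Queries.
Variable N : {N : nat | 1 < N}.
Let R := dense_linear_ordering N.
Local Notation e := (up_log 2 (sval N)).
Implicit Types (x y : 'I_(sval N)).

(** Only pairs with increasing labels carry a bit: the reversed pair is its negation by totality,
    the diagonal is constantly false. *)
Lemma dt_computes_prec x y : dt_computes 1 (fun w : qinst R => dlo_prec w x y).
Proof.
case: (ltngtP x y) => [ltxy|ltyx|/val_inj ->].
- exact: (dt_computes_bit (R := R) (inl (exist _ (x, y) ltxy))).
- have [t tn tP] := dt_computes_comp negb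
    (dt_computes_bit (R := R) (inl (exist _ (y, x) ltyx))).
  exists t => // w; rewrite tP /=.
  have neq : x != y by rewrite -val_eqE gtn_eqF.
  by have := dlo_prec_tot w neq; do 2!case: dlo_prec.
- apply: dt_computes_leq (leq0n _) _; have [t tn tP] := dt_computes_const R false.
  by exists t => // w; rewrite tP; apply/esym/negbTE/dlo_prec_irr.
Qed.

Lemma dt_computes_med x y :
  dt_computes e (fun w : qinst R => dlo_med w x y).
Proof.
wlog lexy: x y / x <= y => [sym|].
  have [/sym//|/ltnW/sym [t tn tP]] := leqP x y.
  by exists t => // w; rewrite tP; apply: dlo_medC.
pose bit k : qbit R := inr (exist _ (x, y) lexy, k).
(* Decoding searches for a point with the given bits. The default [x] is never returned, as the
   median itself matches; the match is unique by [ord_bit_inj]. *)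
pose dec (s : seq bool) : 'I_(sval N) :=
  odflt x [pick v : 'I_(sval N) | [seq nat_bit v k | k : 'I_e <- enum 'I_e] == s].
have := dt_computes_comp dec (dt_computes_map (enum 'I_e)
   (fun k => dt_computes_bit (bit k))).
rewrite size_enum_ord muln1 => -[t tn tP]; exists t => // w; rewrite tP /dec.
case: pickP => [v /eqP/eq_in_map eqv|/(_ (dlo_med w x y))] /=; last by rewrite eqxx.
by apply: ord_bit_inj => k; apply: eqv; rewrite mem_enum.
Qed.

Lemma dt_computes_valid (s : qsol R) :
  dt_computes (e + 3) (fun w : qinst R => qvalid w s).
Proof.
case: s => [[[x y] z]|[x y]] /=.
  apply: (@dt_computes_leq _ _ (1 + (1 + 1))); first lia.
  by apply: dt_computes_and; last apply: dt_computes_and; apply: dt_computes_prec.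
apply: (@dt_computes_leq _ _ (1 + (e + (1 + 1)))); first lia.
apply: dt_computes_and; first exact: dt_computes_prec.
apply: (dt_computes_bind (G := fun m (w : qinst R) =>
  ~~ (dlo_prec w x m && dlo_prec w m y))
  (dt_computes_med x y)) => m.
by apply/dt_computes_comp/dt_computes_and; apply: dt_computes_prec.
Qed.

End Queries.

(** * Bisection by medians and binary search *)

Section Bisection.
Variables (N : nat) (w : dlo_input N).
Implicit Types (x y z : 'I_N) (J : 'I_N * 'I_N) (p : seq bool) (S : seq 'I_N).
Local Notation "x ≺ y" := (dlo_prec w x y) (at level 70).

Definition bisect J (b : bool) : 'I_N * 'I_N :=
  let m := dlo_med w J.1 J.2 in if b then (m, J.2) else (J.1, m).

(** A point equal to the median goes right, in agreement with [bisect], where the median is the left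
    endpoint of the right half. *)
Fixpoint locate J z n : seq bool :=
  if n is n'.+1 then
    let b := ~~ (z ≺ dlo_med w J.1 J.2) in b :: locate (bisect J b) z n'
  else [::].

(** Both endpoints are listed at every level, repetitions included, so that the length depends only
    on that of [p]. *)
Fixpoint endpoints J p : seq 'I_N :=
  [:: J.1, J.2 & if p is b :: p' then endpoints (bisect J b) p' else [::]].

Lemma size_endpoints J p : size (endpoints J p) = (size p).+1.*2.
Proof. by elim: p J => //= b p IHp J; rewrite IHp. Qed.

Lemma dlo_prec_asym x y : x ≺ y -> ~~ (y ≺ x).
Proof.
have [->|neq] := eqVneq x y; first by rewrite (negbTE (dlo_prec_irr _ _)).
by have := dlo_prec_tot w neq; do 2!case: dlo_prec.
Qed.

(** Without solutions inside [S], the order is transitive and dense on [S], and every interval met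
    on the way contains the final left endpoint; comparing it with the median then returns the bit
    of [p]. [S] stays fixed while [J] shrinks. *)
Lemma locate_endpoint S J p :
  {in S & &, forall x y z, ~~ dlo_valid w (inl (x, y, z))} ->
  {in S &, forall x y, ~~ dlo_valid w (inr (x, y))} ->
  {subset endpoints J p <= S} -> J.1 ≺ J.2 ->
  locate J (foldl bisect J p).1 (size p) = p.
Proof.
move=> noL noD.
have trS : {in S & &, forall x y z, x ≺ y -> y ≺ z -> x ≺ z}.
  move=> x y z xS yS zS xy yz; have := noL x y z xS yS zS; rewrite /= xy yz /=.
  have [eqxz|neq] := eqVneq x z.
    by have := dlo_prec_asym xy; rewrite eqxz yz.
  by have := dlo_prec_tot w neq; do 2!case: dlo_prec.
have denS x y : x \in S -> y \in S -> x ≺ y -> x ≺ dlo_med w x y /\ dlo_med w x y ≺ y.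
  by move=> xS yS xy; have := noD x y xS yS; rewrite /= xy negbK => /andP.
move=> sub lt12.
(* The induction needs [z] in the half-open interval from [J.1] to [J.2]: the left bound decides the
   bit [true], the right bound the bit [false]. *)
suff [] : let z := (foldl bisect J p).1 in
  [/\ z \in S, (J.1 == z) || (J.1 ≺ z), z ≺ J.2 & locate J z (size p) = p] by [].
elim: p J sub lt12 => [|b p IHp] J sub lt12.
  by rewrite /= eqxx; split=> //; apply: sub; rewrite !inE eqxx.
have J1S : J.1 \in S by apply: sub; rewrite !inE eqxx.
have J2S : J.2 \in S by apply: sub; rewrite !inE eqxx orbT.
have [lt1m ltm2] := denS _ _ J1S J2S lt12.
have sub' : {subset endpoints (bisect J b) p <= S}.
  by move=> x xp; apply: sub; rewrite !inE xp !orbT.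
(* The median is an endpoint of either half, hence among the endpoints listed for the next level. *)
have mS : dlo_med w J.1 J.2 \in S.
  by apply: sub'; case: p {IHp sub} => [|c p]; case: b; rewrite /= !inE eqxx ?orbT.
have ltJ' : (bisect J b).1 ≺ (bisect J b).2 by case: b {sub sub'}.
have [] := IHp _ sub' ltJ'; rewrite /=.
move: (foldl _ _ _).1 => z zS le1z ltz2 eqp.
have bE : ~~ (z ≺ dlo_med w J.1 J.2) = b.
  case: b le1z ltz2 {sub sub' ltJ' eqp} => /= le1z ltz2; last by rewrite ltz2.
  case/orP: le1z => [/eqP <-|]; [exact: dlo_prec_irr | exact: dlo_prec_asym].
split=> //; last by rewrite bE eqp.
  case: b le1z {sub sub' ltJ' eqp bE ltz2} => //= le1z.
  case/orP: le1z => [/eqP <-|ltmz]; rewrite ?lt1m ?orbT //.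
  by rewrite (trS _ _ _ J1S mS zS lt1m ltmz) orbT.
case: b ltz2 {sub sub' ltJ' eqp bE le1z} => //= ltz2.
exact: (trS _ _ _ zS mS J2S ltz2 ltm2).
Qed.

End Bisection.

(** * Query cost of bisection and binary search *)

Section BisectionQueries.
Variable N : {N : nat | 1 < N}.
Let R := dense_linear_ordering N.
Local Notation e := (up_log 2 (sval N)).
Implicit Types (z : 'I_(sval N)) (J : 'I_(sval N) * 'I_(sval N)) (p : seq bool).

(** The labels 0 and 1, which exist as N > 1, in the order that [w] gives them. *)
Definition first_interval (w : qinst R) : 'I_(sval N) * 'I_(sval N) :=
  let a := Ordinal (ltnW (svalP N)) in let b := Ordinal (svalP N) in
  if dlo_prec w a b then (a, b) else (b, a).

Lemma first_interval_prec (w : qinst R) :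
  dlo_prec w (first_interval w).1 (first_interval w).2.
Proof.
rewrite /first_interval; set a := Ordinal _; set b := Ordinal (svalP N).
have neq : a != b by [].
by have := dlo_prec_tot w neq; case: ifP => //=; case: dlo_prec.
Qed.

Lemma dt_computes_first_interval : dt_computes 1 first_interval.
Proof.
exact: (dt_computes_comp (fun c : bool => if c then _ else _) (dt_computes_prec _ _)).
Qed.

Lemma dt_computes_bisect J b : dt_computes e (fun w : qinst R => bisect w J b).
Proof.
exact: (dt_computes_comp (fun m => if b then (m, J.2) else (J.1, m)) (dt_computes_med _ _)).
Qed.

Lemma dt_computes_foldl_bisect J p :
  dt_computes (size p * e) (fun w : qinst R => foldl (bisect w) J p).
Proof.
elim: p J => [|b p IHp] J /=; first exact: dt_computes_const.
rewrite mulSn.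
exact: (dt_computes_bind (G := fun J' (w : qinst R) => foldl (bisect w) J' p)
  (dt_computes_bisect J b)).
Qed.

Lemma dt_computes_endpoints J p :
  dt_computes (size p * e) (fun w : qinst R => endpoints w J p).
Proof.
elim: p J => [|b p IHp] J /=; first exact: dt_computes_const.
rewrite mulSn.
apply: (dt_computes_bind (G := fun J' (w : qinst R) => [:: J.1, J.2 & endpoints w J' p])
  (dt_computes_bisect J b)) => J'.
exact: (dt_computes_comp (fun s => [:: J.1, J.2 & s]) (IHp J')).
Qed.

Lemma dt_computes_locate J z n :
  dt_computes (n * (e + 1)) (fun w : qinst R => locate w J z n).
Proof.
elim: n J => [|n IHn] J /=; first exact: dt_computes_const.
rewrite mulSn -addnA.
(* [bisect] is unfolded so that one reading of the median serves both the comparison and the next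
   interval. *)
apply: (dt_computes_bind (G := fun m (w : qinst R) => let b := ~~ dlo_prec w z m in
  b :: locate w (if b then (m, J.2) else (J.1, m)) z n) (dt_computes_med _ _)) => m.
apply: (dt_computes_bind (G := fun c (w : qinst R) =>
  ~~ c :: locate w (if ~~ c then (m, J.2) else (J.1, m)) z n) (dt_computes_prec z m)) => c.
exact: (dt_computes_comp (cons (~~ c)) (IHn _)).
Qed.

End BisectionQueries.

(** * The Lossy-Code instance and the map back of solutions *)

Section Reduction.
Variable N : {N : nat | 1 < N}.
Let R := dense_linear_ordering N.
Local Notation e := (up_log 2 (sval N)).

Lemma leq_exp_up_log : sval N <= 2 ^ e.
Proof. exact: up_logP. Qed.

(** With M a power of two, [2M] is in bijection with the bit strings of length e + 1. *)
Definition code_size : {M : nat | 0 < M} := exist _ (2 ^ e) (expn_gt0 2 e).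
Let S := lossy_code code_size.

Lemma card_path : #|{: e.+1.-tuple bool}| = 2 * 2 ^ e.
Proof. by rewrite card_tuple card_bool expnS. Qed.

Definition path_of_code (o : qsol S) : e.+1.-tuple bool :=
  enum_val (cast_ord (esym card_path) o).

Definition code_of_path (s : seq bool) : qsol S :=
  cast_ord card_path (enum_rank (insubd (nseq_tuple e.+1 false) s : e.+1.-tuple bool)).

Lemma path_of_codeK (o : qsol S) : code_of_path (path_of_code o) = o.
Proof. by rewrite /code_of_path valKd enum_valK cast_ordKV. Qed.

(** Indices from N on are padding and get an arbitrary code: [decode] only takes values below N. *)
Definition encode (w : qinst R) (i : 'I_(2 ^ e)) : qsol S :=
  if insub (val i) is Some z
  then code_of_path (locate w (first_interval w) z e.+1) else code_of_path [::].

Definition decode (w : qinst R) (o : qsol S) : 'I_(2 ^ e) :=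
  widen_ord leq_exp_up_log (foldl (bisect w) (first_interval w) (path_of_code o)).1.

Definition to_lossy (w : qinst R) : qinst S :=
  LossyInput [ffun i => encode w i] [ffun o => decode w o].

Local Notation T := (e.+2.*2).

(** Candidates are indexed by positions in the list of endpoints, whose length is [T] for a path of
    length e + 1; this makes them a fixed finite family of T^3 + T^2 tests. *)
Definition sol_map (h : 'I_T -> 'I_(sval N)) (s : dlo_sol T) : qsol R :=
  match s with
  | inl (i, j, k) => inl (h i, h j, h k)
  | inr (i, j) => inr (h i, h j)
  end.

Definition first_valid (h : 'I_T -> 'I_(sval N)) (w : qinst R) : qsol R :=
  let cs := [seq sol_map h s | s <- enum (dlo_sol T : finType)] in
  nth (inr (Ordinal (svalP N), Ordinal (svalP N))) cs (find (qvalid w) cs).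

Definition solution_of_code (o : qsol S) (w : qinst R) : qsol R :=
  first_valid (fun i =>
    nth (Ordinal (svalP N)) (endpoints w (first_interval w) (path_of_code o)) i) w.

Lemma first_valid_valid (h : 'I_T -> 'I_(sval N)) (w : qinst R) (s : dlo_sol T) :
  qvalid w (sol_map h s) -> qvalid w (first_valid h w).
Proof.
move=> vs; apply: nth_find; apply/hasP; exists (sol_map h s) => //.
by apply: map_f; rewrite mem_enum.
Qed.

Lemma solution_of_code_valid (w : qinst R) (o : qsol S) :
  qvalid (to_lossy w) o -> qvalid w (solution_of_code o w).
Proof.
(* By contraposition: if no candidate is valid, the endpoints on the path of [o] contain no
   solution, and [locate_endpoint] yields f (g o) = o. *)
set p := path_of_code o; set J := first_interval w; apply: contraLR => novalid.
set h := fun i : 'I_T => nth (Ordinal (svalP N)) (endpoints w J p) i.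
have nov s : ~~ qvalid w (sol_map h s).
  by apply: contra novalid; apply: first_valid_valid.
have hP x : x \in endpoints w J p -> exists i, x = h i.
  move=> /(nthP (Ordinal (svalP N))) [i]; rewrite size_endpoints size_tuple => lti <-.
  by exists (Ordinal lti).
have eqp : locate w J (foldl (bisect w) J p).1 (size p) = p.
  apply: (locate_endpoint (S := endpoints w J p)) => //.
  - move=> x y z /hP [i ->] /hP [j ->] /hP [k ->].
    exact: (nov (inl (i, j, k))).
  - by move=> x y /hP [i ->] /hP [j ->]; apply: (nov (inr (i, j))).
  - exact: first_interval_prec.
rewrite /= /lossy_valid /= negbK !ffunE /encode.
(* Widening preserves the underlying number, so [insub] recovers the left endpoint itself. *)
rewrite [val _]/(val (foldl (bisect w) J p).1) valK -[X in _ == X]path_of_codeK.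
by move: eqp; rewrite size_tuple => ->.
Qed.

Lemma dt_computes_encode i : dt_computes (1 + e.+1 * (e + 1)) (encode^~ i).
Proof.
rewrite /encode; case: insubP => [z _ _|_]; last first.
  exact: dt_computes_leq (leq0n _) (dt_computes_const _ _).
apply: (dt_computes_bind (G := fun J (w : qinst R) => code_of_path (locate w J z e.+1))
  (dt_computes_first_interval N)) => J.
exact/dt_computes_comp/dt_computes_locate.
Qed.

Lemma dt_computes_decode o : dt_computes (1 + e.+1 * e) (decode^~ o).
Proof.
apply: (dt_computes_bind (G := fun J (w : qinst R) => widen_ord leq_exp_up_log
  (foldl (bisect w) J (path_of_code o)).1) (dt_computes_first_interval N)) => J.
apply: (dt_computes_comp (fun J' : _ * _ => widen_ord leq_exp_up_log J'.1)).
by have := dt_computes_foldl_bisect J (path_of_code o); rewrite size_tuple.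
Qed.

(** A single bit is obtained by computing the whole value of f or g. *)
Lemma dt_computes_to_lossy (b : qbit S) :
  dt_computes (1 + e.+1 * (e + 1)) (fun w => qenc (to_lossy w) b).
Proof.
case: b => -[i k].
  have [t tn tP] := dt_computes_comp (fun o : qsol S => nat_bit o k) (dt_computes_encode i).
  by exists t => // w; rewrite tP /= ffunE.
have [t tn tP] :=
  dt_computes_comp (fun j : 'I_(2 ^ e) => nat_bit j k) (dt_computes_decode i).
exists t => [|w]; last by rewrite tP /= ffunE.
by apply: leq_trans tn _; rewrite leq_add2l leq_mul2l leq_addr orbT.
Qed.

Lemma dt_computes_first_valid h : dt_computes ((T ^ 3 + T ^ 2) * (e + 3)) (first_valid h).
Proof.
have -> : T ^ 3 + T ^ 2 = size [seq sol_map h s | s <- enum (dlo_sol T : finType)].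
  by rewrite size_map -cardT card_sum !card_prod card_ord !expnS expn0 muln1 mulnA.
apply: (dt_computes_comp (nth _ _)); apply: dt_computes_find => s.
exact: dt_computes_valid.
Qed.

Lemma dt_computes_solution_of_code o :
  dt_computes (1 + (e.+1 * e + (T ^ 3 + T ^ 2) * (e + 3))) (solution_of_code o).
Proof.
apply: (dt_computes_bind (G := fun J (w : qinst R) => first_valid (fun i =>
  nth (Ordinal (svalP N)) (endpoints w J (path_of_code o)) i) w)
  (dt_computes_first_interval N)) => J.
have := dt_computes_endpoints J (path_of_code o); rewrite size_tuple => cE.
apply: (dt_computes_bind (G := fun s (w : qinst R) => first_valid (fun i =>
  nth (Ordinal (svalP N)) s i) w) cE) => s.
exact: dt_computes_first_valid.
Qed.

Lemma up_log_card_lossy_bit : up_log 2 #|qbit S| <= 4 * e + 1.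
Proof.
have -> : 4 * e + 1 = up_log 2 (2 ^ (4 * e + 1)) by rewrite up_expnK.
apply: leq_up_log; rewrite /= card_sum !card_prod !card_ord -expnS !up_expnK //.
(* The number of bits is 2^e (e + 1) + 2^(e+1) e = 2^e (3e + 1), and 3e + 1 < 2^(3e+1). *)
have := ltn_expl (3 * e + 1) (isT : 1 < 2).
rewrite [4 * e + 1](_ : _ = e + (3 * e + 1)); last lia.
by rewrite (expnD 2 e) (expnS 2 e) -mulnA mulnCA -mulnDr leq_mul2l; lia.
Qed.

Lemma up_log_card_dlo_bit : e <= up_log 2 #|qbit R|.
Proof.
have e_gt0 : 0 < e by rewrite up_log_gt0 (svalP N).
apply: leq_up_log => //=.
(* Bit 0 of the median of (x, x), one for each point x, already gives N input bits; it exists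
   because e > 0. *)
have inj : injective (fun x : 'I_(sval N) =>
    inr (exist _ (x, x) (leqnn x), Ordinal e_gt0) : qbit R).
  by move=> x y [].
by have := leq_card _ inj; rewrite card_ord.
Qed.

End Reduction.

(** * The polylogarithmic bound and the assembly of the reduction *)

Lemma polylog_bound c e L : 5000 <= c -> 0 < e <= L ->
  4 * e + 1 + (1 + (e.+1 * e + (e.+2.*2 ^ 3 + e.+2.*2 ^ 2) * (e + 3))) <= c * L ^ c + c.
Proof.
move=> c5 /andP [e0 eL].
(* The cost is of degree 4 in e: cubically many candidates, each tested with O(e) queries. As e >=
   1, the coefficients add up to at most 4 + 1 + 1 + 2 + 252 * 4 = 1016, well below 5000. *)
apply: (@leq_trans (c * e ^ 4)).
  have pow k : k <= 4 -> e ^ k <= e ^ 4 by apply: leq_pexp2l.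
  have Te : e.+2.*2 <= 6 * e by lia.
  have T3 : e.+2.*2 ^ 3 <= 6 ^ 3 * e ^ 3 by rewrite -expnMn leq_exp2r.
  have T2 : e.+2.*2 ^ 2 <= 6 ^ 2 * e ^ 3.
    apply: leq_trans (_ : (6 * e) ^ 2 <= _); first by rewrite leq_exp2r.
    by rewrite expnMn leq_mul2l leq_pexp2l.
  have T32 : (e.+2.*2 ^ 3 + e.+2.*2 ^ 2) * (e + 3) <= 252 * e ^ 3 * (4 * e).
    by apply: leq_mul; lia.
  have e34 : e ^ 3 * e = e ^ 4 by rewrite -expnSr.
  have e2 : e.+1 * e <= 2 * e ^ 4.
    by apply: (@leq_trans (2 * e ^ 2)); [rewrite expnS expn1; nia | rewrite leq_mul2l pow].
  have e1 : e <= e ^ 4 by have := pow 1; rewrite expn1; apply.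
  have : 5000 * e ^ 4 <= c * e ^ 4 by rewrite leq_mul2r c5 orbT.
  move: T32; rewrite mulnACA e34; lia.
apply: leq_trans (leq_addr _ _); rewrite leq_mul2l; apply/orP; right.
apply: (@leq_trans (e ^ c)); last by rewrite leq_exp2r; lia.
by rewrite leq_pexp2l //; lia.
Qed.

Theorem theorem1p9 : dense_linear_ordering <=dt lossy_code.
Proof.
(* One [c] serves as factor, exponent and additive term; only its lower bound is kept. *)
have [c c5] : exists c, 5000 <= c by exists 5000.
exists c => N; exists (code_size N).
set e := up_log 2 (sval N).
pose n := 1 + (e.+1 * e + (e.+2.*2 ^ 3 + e.+2.*2 ^ 2) * (e + 3)).
have cT (b : qbit (lossy_code (code_size N))) :
    dt_computes n (fun w => qenc (to_lossy w) b).
  apply: dt_computes_leq (dt_computes_to_lossy b).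
  (* The cost of f exceeds 1 + (e + 1) e by e + 1, which the candidate tests in [n] absorb. *)
  have : e + 3 <= (e.+2.*2 ^ 3 + e.+2.*2 ^ 2) * (e + 3).
    by rewrite leq_pmull // addn_gt0 expn_gt0.
  by rewrite -/e /n; move: (_ * (e + 3)) => X; lia.
have [T [G [redTG leTG]]] := dt_reduction_of_computes cT
  (@dt_computes_solution_of_code N) (@solution_of_code_valid N).
exists T, G; split=> //; apply: leq_trans leTG _.
apply: leq_trans (leq_add (up_log_card_lossy_bit N) (leqnn n)) _.
by apply: polylog_bound; rewrite // up_log_card_dlo_bit up_log_gt0 (svalP N).
Qed.
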